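(* Let $W$ be a finite Coxeter group. Then for any $u, w \in W$, we have $\Phi_{u \vee w} = \overline{\Phi_u \cup \Phi_w}^{\mathrm{br}}$, where $u\vee w$ is the join in the right weak order and $\overline{\,\cdot\,}^{\mathrm{br}}$ is the Bruhat preclosure.
   Context: Let $(W,S)$ be a Coxeter system with length function $\ell$. Let $\Phi$ be the root system of $(W,S)$ (in the standard geometric representation), $\Phi^+$ the set of positive roots with respect to $S$, $\Phi^-=-\Phi^+$. For $\alpha\in\Phi$, $s_\alpha\in W$ denotes the reflection in $\alpha$. For $w \in W$ the inversion set is $\Phi_w = \Phi^+ \cap w(\Phi^-)$. The (right) weak order on $W$ is defined by $u \le w$ if and only if $\Phi_u \subseteq \Phi_w$. When $W$ is finite it is a lattice, and $u\vee w$ denotes the join of $u$ and $w$. For $A\subseteq\Phi^+$, the Bruhat preclosure $\overline{A}^{\mathrm{br}}$ is the set of those $\alpha \in \Phi^+$ for which there exist $\alpha_1, \ldots, \alpha_m \in A$ such that $s_\alpha = s_{\alpha_1} \cdots s_{\alpha_m}$ and $0 < \ell(s_{\alpha_1}) < \ell(s_{\alpha_1} s_{\alpha_2}) < \cdots < \ell(s_{\alpha_1} s_{\alpha_2} \cdots s_{\alpha_m})$. *)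

(* Defs.v *)
From HB Require Import structures.
From mathcomp Require Import all_boot all_order all_algebra all_fingroup.
From mathcomp Require Import boolp classical_sets reals trigo.
Set Implicit Arguments.
Unset Strict Implicit.
Unset Printing Implicit Defensive.
Import Order.TTheory GRing.Theory Num.Theory.

Local Open Scope ring_scope.
Local Open Scope classical_set_scope.

(* W is presented by the generators S and the relations (s t)^m(s, t) = 1, where
   m(s, t) is the order of s t in W; since #[s * s] = 1, the relation for s = t
   is s ^ 2 = 1.  Only the values of f on S matter.  H may be infinite. *)
Definition coxeter_presentation (W : finGroupType) (S : {set W}) : Prop :=
  forall (H : groupType) (f : W -> H),
    (forall s t, s \in S -> t \in S -> ((f s * f t) ^+ #[s * t] = 1)%g) ->
    exists phi : {multiplicative W -> H}, forall s, s \in S -> phi s = f s.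

(* Finite Coxeter systems (W, S), as in Bourbaki, Lie IV.1.3. *)
Record coxeterSystem := CoxeterSystem {
  cox_group :> finGroupType;
  simple_gens : {set cox_group};
  simple_involution : forall s, s \in simple_gens -> #[s]%g = 2%N;
  simple_generates : <<simple_gens>>%g = [set: cox_group]%SET;
  simple_presents : coxeter_presentation simple_gens
}.

Arguments simple_gens : clear implicits.

Section Words.
Variable C : coxeterSystem.

Definition rank := #|simple_gens C|.
Definition simple_elt (i : 'I_rank) : C := enum_val i.

Definition word_prod (c : seq 'I_rank) : C := (\prod_(i <- c) simple_elt i)%g.

Lemma word_exists (w : C) : exists c : seq 'I_rank, word_prod c == w.
Proof.
have /gen_prodgP[n [c cS ->]] : w \in <<simple_gens C>>%g.
  by rewrite simple_generates inE.
exists [seq enum_rank_in (cS i) (c i) | i <- index_enum 'I_n].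
rewrite /word_prod big_map; apply/eqP/eq_bigr => i _.
by rewrite /simple_elt enum_rankK_in.
Qed.

Lemma word_length_exists (w : C) :
  exists k, [exists c : k.-tuple 'I_rank, word_prod c == w].
Proof.
have [c cw] := word_exists w.
by exists (size c); apply/existsP; exists (in_tuple c).
Qed.

Definition cox_length (w : C) : nat := ex_minn (word_length_exists w).

(* A fixed but arbitrary expression of w in the simple generators. *)
Definition some_word (w : C) : seq 'I_rank := xchoose (word_exists w).

End Words.

Section GeometricRepresentation.
Variables (R : realType) (C : coxeterSystem).

(* Coordinate vectors in the basis of simple roots. *)
Local Notation V := 'rV[R]_(rank C).

Definition simple_root (i : 'I_(rank C)) : V := delta_mx 0 i.

Definition form_mx : 'M[R]_(rank C) :=
  \matrix_(i, j) - cos (pi / #[simple_elt i * simple_elt j]%g%:R).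

Definition form (u v : V) : R := (u *m form_mx *m v^T) 0 0.

Definition simple_reflection (i : 'I_(rank C)) (v : V) : V :=
  v - (2 * form (simple_root i) v) *: simple_root i.

(* The left action of W on V.  The simple reflections satisfy the defining
   relations of W, so the choice of the expression of w is irrelevant. *)
Definition geom_act (w : C) (v : V) : V :=
  foldr simple_reflection v (some_word w).

Definition roots : set V :=
  [set a | exists w i, a = geom_act w (simple_root i)].

Definition positive_roots : set V :=
  [set a | roots a /\ forall i, 0 <= a 0 i].

Definition negative_roots : set V :=
  [set - a | a in positive_roots].

(* The reflection in the root a = w(alpha_i) is w s_i w^-1; it depends only on
   a.  The value is 1 if a is not a root. *)
Definition root_reflection (a : V) : C :=
  xget 1%g [set t | exists w i, a = geom_act w (simple_root i) /\
                                t = (w * simple_elt i * w^-1)%g].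

Definition inversions (w : C) : set V :=
  positive_roots `&` geom_act w @` negative_roots.

Definition weak_le (u w : C) : Prop := inversions u `<=` inversions w.

Definition is_join (u w v : C) : Prop :=
  [/\ weak_le u v, weak_le w v &
      forall x, weak_le u x -> weak_le w x -> weak_le v x].

(* The weak order of a finite Coxeter group is a lattice, so the default value
   1 is never used. *)
Definition weak_join (u w : C) : C := xget 1%g [set v | is_join u w v].

Definition reflection_prod (l : seq V) : C :=
  (\prod_(a <- l) root_reflection a)%g.

Definition length_increasing (l : seq V) : Prop :=
  path ltn 0%N [seq cox_length (reflection_prod (take k l)) | k <- iota 1%N (size l)].

Definition bruhat_preclosure (A : set V) : set V :=
  [set a | positive_roots a /\
     exists l : seq V,
       [/\ forall b, b \in l -> A b,
           root_reflection a = reflection_prod l &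
           length_increasing l]].

End GeometricRepresentation.

Arguments inversions R {C} w.
Arguments weak_le R {C} u w.
Arguments weak_join R {C} u w.

(* Main.v *)
Require Import Defs.
From HB Require Import structures.
From mathcomp Require Import all_boot all_order all_algebra all_fingroup.
From mathcomp Require Import boolp classical_sets reals trigo.
From mathcomp Require Import ring lra zify.
(* Imported again because mathcomp has its own form_mx. *)
Require Import Defs.
Set Implicit Arguments.
Unset Strict Implicit.
Unset Printing Implicit Defensive.
Import Order.TTheory GRing.Theory Num.Theory.
Local Open Scope ring_scope.
Local Open Scope classical_set_scope.

(* Let v be an upper bound of u and w of minimal length; write N for inversion
   sets and A = N(u) U N(w).  If x_0 = 1, x_1, ... is an increasing path with
   labels in N(x), then x_i x gets shorter at each step, so the preclosure of A
   lies in N(x) for every upper bound x.  It remains to connect s_a, for a in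
   N(v), to 1 by decreasing steps with labels in A; this shows N(v) is the
   preclosure, hence v is the join.

   Equivalently, one climbs in Bruhat order from y = s_a v to v.  Put g = v^-1,
   p = g u, q = g w; an admissible step is y -> y s_b > y with b in N(g) but not
   in both N(p) and N(q), and one stays below v.  Let c = z s_r be of minimal
   length with N(c) in N(g) and N(c) not in N(y^-1), and let b = z(alpha_r) be
   its last inversion.  Then y s_b <= v by lifting along z.  The key point is
   that every x with N(x) in N(g) and b in N(x) satisfies N(c) in N(x): so if b
   were in N(p) and N(q), a left descent s of c would lie in both, and v s would
   be a shorter upper bound. *)

(** * The geometric representation *)

Section GeneralLinearGroup.
Variables (R : realType) (n : nat).

(** [coxeter_presentation] yields homomorphisms into a [groupType], so the invertible matrices over
    [R] are packaged as one. *)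
Record gl := GL { gl_val :> 'M[R]_n; gl_unit : gl_val \in unitmx }.

HB.instance Definition _ := [isSub for gl_val].
HB.instance Definition _ := [Choice of gl by <:].

Definition gl_one := GL (unitmx1 R n).
Definition gl_inv (A : gl) : gl :=
  @GL (invmx A) (etrans (unitmx_inv A) (gl_unit A)).

Lemma gl_mul_unit (A B : gl) : (A : 'M[R]_n) *m B \in unitmx.
Proof. by rewrite unitmx_mul !gl_unit. Qed.

Definition gl_mul (A B : gl) : gl := GL (gl_mul_unit A B).

Lemma gl_mulA : associative gl_mul.
Proof. by move=> A B D; apply: val_inj; apply: mulmxA. Qed.
Lemma gl_mul1 : left_id gl_one gl_mul.
Proof. by move=> A; apply: val_inj; apply: mul1mx. Qed.
Lemma gl_mulr1 : right_id gl_one gl_mul.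
Proof. by move=> A; apply: val_inj; apply: mulmx1. Qed.
Lemma gl_mulV : left_inverse gl_one gl_inv gl_mul.
Proof. by move=> A; apply: val_inj; apply: mulVmx; apply: gl_unit. Qed.
Lemma gl_mulrV : right_inverse gl_one gl_inv gl_mul.
Proof. by move=> A; apply: val_inj; apply: mulmxV; apply: gl_unit. Qed.

HB.instance Definition _ :=
  isGroup.Build gl gl_mulA gl_mul1 gl_mulr1 gl_mulV gl_mulrV.

End GeneralLinearGroup.

Section GeometricAction.
Variables (R : realType) (C : coxeterSystem).
Local Notation n := (rank C).
Local Notation V := 'rV[R]_n.
Local Notation root := (@simple_root R C).
Local Notation s := (@simple_elt C).
Local Notation B := (@form R C).
Local Notation sigma := (@simple_reflection R C).
Implicit Types (i j : 'I_n) (u v : V).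

Lemma simple_elt_in i : s i \in simple_gens C.
Proof. exact: enum_valP. Qed.

Lemma simple_elt_inj : injective s.
Proof. exact: enum_val_inj. Qed.

Lemma simple_eltK i : (s i * s i = 1)%g.
Proof.
by rewrite -(expg_order (s i)) (simple_involution (simple_elt_in i)).
Qed.

Lemma simple_eltV i : ((s i)^-1 = s i)%g.
Proof. by apply/eqP; rewrite eq_invg_mul simple_eltK. Qed.

Lemma order_sC i j : #[s i * s j]%g = #[s j * s i]%g.
Proof. by rewrite -orderV invMg !simple_eltV. Qed.

Lemma formC u v : B u v = B v u.
Proof.
have -> : B u v = (u *m form_mx R C *m v^T)^T 0 0 by rewrite mxE.
have FT : (form_mx R C)^T = form_mx R C.
  by apply/matrixP => i j; rewrite !mxE order_sC.
by rewrite /form !trmx_mul trmxK FT mulmxA.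
Qed.

Lemma formDl u v w : B (u + v) w = B u w + B v w.
Proof. by rewrite /form !mulmxDl mxE. Qed.
Lemma formZl a u w : B (a *: u) w = a * B u w.
Proof. by rewrite /form -!scalemxAl mxE. Qed.
Lemma formNl u w : B (- u) w = - B u w.
Proof. by rewrite /form !mulNmx mxE. Qed.
Lemma formDr u v w : B w (u + v) = B w u + B w v.
Proof. by rewrite formC formDl !(formC _ w). Qed.
Lemma formZr a u w : B w (a *: u) = a * B w u.
Proof. by rewrite formC formZl formC. Qed.
Lemma formNr u w : B w (- u) = - B w u.
Proof. by rewrite formC formNl formC. Qed.
Definition formE := (formDl, formDr, formZl, formZr, formNl, formNr).

Lemma form_simple i j :
  B (root i) (root j) = - cos (pi / #[s i * s j]%g%:R).
Proof.
rewrite /form /simple_root -rowE trmx_delta -colE !mxE //.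
Qed.

Lemma form_simple1 i : B (root i) (root i) = 1.
Proof. by rewrite form_simple simple_eltK order1 divr1 cospi opprK. Qed.

Definition refl_mx i : 'M[R]_n :=
  1%:M - 2 *: (form_mx R C *m (root i)^T *m root i).

Lemma simple_reflectionE i v : sigma i v = v *m refl_mx i.
Proof.
rewrite /simple_reflection /refl_mx mulmxBr mulmx1 -scalemxAr !mulmxA.
rewrite [v *m _ *m _ *m _]mulmx_sum_row big_ord1 scalerA row_id formC.
by rewrite {1}/form.
Qed.

Lemma sigmaD i u v : sigma i (u + v) = sigma i u + sigma i v.
Proof. by rewrite !simple_reflectionE mulmxDl. Qed.
Lemma sigmaZ i a v : sigma i (a *: v) = a *: sigma i v.
Proof. by rewrite !simple_reflectionE -scalemxAl. Qed.

Lemma sigmaK i : involutive (sigma i).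
Proof.
move=> v; rewrite /simple_reflection !formE form_simple1.
rewrite -addrA -opprD -scalerDl.
rewrite [X in X *: _](_ : _ = 0) ?scale0r ?subr0 //; ring.
Qed.

Lemma refl_mxK i : refl_mx i *m refl_mx i = 1%:M.
Proof.
apply/row_matrixP => k; rewrite !rowE mulmxA -!simple_reflectionE sigmaK.
by rewrite mulmx1.
Qed.

Lemma refl_mx_unit i : refl_mx i \in unitmx.
Proof. by case/mulmx1_unit: (refl_mxK i). Qed.

Lemma form_sigma i u v : B (sigma i u) (sigma i v) = B u v.
Proof.
rewrite /simple_reflection !formE form_simple1 (formC _ (root i)); ring.
Qed.

End GeometricAction.

(** * Alternating products of two simple reflections *)

Section Dihedral.
Variables (R : realType) (C : coxeterSystem).
Local Notation n := (rank C).
Local Notation V := 'rV[R]_n.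
Local Notation root := (@simple_root R C).
Local Notation s := (@simple_elt C).
Local Notation B := (@form R C).
Local Notation sigma := (@simple_reflection R C).
Variables i j : 'I_n.
Hypothesis neq_ij : i != j.
Local Notation m := #[s i * s j]%g.

Definition angle : R := pi / m%:R.

Lemma order_ge2 : (2 <= m)%N.
Proof.
rewrite ltn_neqAle order_gt0 andbT eq_sym order_eq1 -eq_invg_mul simple_eltV.
by rewrite (inj_eq (@simple_elt_inj C)).
Qed.

Lemma order_angle : m%:R * angle = pi.
Proof.
by rewrite /angle mulrC divfK // pnatr_eq0 -lt0n order_gt0.
Qed.

Lemma sin_angle_gt0 : 0 < sin angle.
Proof.
have m_gt1 : 1 < m%:R :> R by rewrite ltr1n order_ge2.
apply: sin_gt0_pi; rewrite divr_gt0 ?pi_gt0 ?(lt_trans ltr01) //=.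
by rewrite ltr_pdivrMr ?(lt_trans ltr01) // ltr_pMr ?pi_gt0.
Qed.

Lemma sin_angle_ge0 k : (k <= m)%N -> 0 <= sin (k%:R * angle).
Proof.
have a_ge0 : 0 <= angle by rewrite divr_ge0 ?pi_ge0.
move=> le_km; apply: sin_ge0_pi; rewrite mulr_ge0 //=.
by rewrite -order_angle ler_wpM2r // ler_nat.
Qed.

Lemma sin_angle_rec k :
  sin (k.+2%:R * angle) =
  2 * cos angle * sin (k.+1%:R * angle) - sin (k%:R * angle).
Proof.
have -> : k.+2%:R * angle = k.+1%:R * angle + angle by rewrite -(natr1 k.+1); ring.
have -> : k%:R * angle = k.+1%:R * angle - angle by rewrite -(natr1 k); ring.
by rewrite sinD sinB; ring.
Qed.

(* The letters of the alternating word [... s_i s_j], read from the right. *)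
Definition alt_letter (q : nat) : 'I_n := if odd q then i else j.

Fixpoint alt_act (q : nat) (v : V) : V :=
  if q is q'.+1 then sigma (alt_letter q') (alt_act q' v) else v.

Lemma alt_letterSS q : alt_letter q.+2 = alt_letter q.
Proof. by rewrite /alt_letter /= negbK. Qed.

Lemma form_alt q :
  B (root (alt_letter q)) (root (alt_letter q.+1)) = - cos angle.
Proof. by rewrite /alt_letter /=; case: odd; rewrite form_simple // order_sC. Qed.

Lemma alt_act_root q :
  sin angle *: alt_act q (root i) =
  sin (q.+1%:R * angle) *: root (alt_letter q.+1)
  + sin (q%:R * angle) *: root (alt_letter q).
Proof.
elim: q => [|q IHq]; first by rewrite mul1r mul0r sin0 scale0r addr0.
rewrite alt_letterSS [alt_act _ _]/= -sigmaZ IHq sigmaD !sigmaZ.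
rewrite /simple_reflection form_simple1 form_alt sin_angle_rec.
move: (root _) (root _) (sin _) (sin _) => a b x y.
apply/rowP => k; rewrite !mxE; ring.
Qed.

Lemma alt_act_double k v :
  alt_act k.*2 v = iter k (sigma i \o sigma j) v.
Proof. by elim: k => //= k ->; rewrite /alt_letter /= !odd_double. Qed.

(** The [m] rounds use [m.*2] letters, which advance the argument of the sine by a full turn. *)
Lemma iter_order_root : iter m (sigma i \o sigma j) (root i) = root i.
Proof.
apply: (scalerI (lt0r_neq0 sin_angle_gt0)).
rewrite -alt_act_double alt_act_root.
have e : m.*2%:R * angle = pi *+ 2.
  by rewrite -muln2 natrM mulrAC order_angle mulr_natr.
rewrite e sin2pi scale0r addr0 -natr1 mulrDl e mul1r addrC sinD2pi.
by rewrite /alt_letter /= odd_double.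
Qed.

End Dihedral.

(** * The action of the Coxeter group on the root space *)

Section Representation.
Variables (R : realType) (C : coxeterSystem).
Local Notation n := (rank C).
Local Notation V := 'rV[R]_n.
Local Notation root := (@simple_root R C).
Local Notation s := (@simple_elt C).
Local Notation B := (@form R C).
Local Notation sigma := (@simple_reflection R C).
Implicit Types (i j : 'I_n) (u v : V) (w : C).

Lemma iter_sigma_lin i j k (a : R) u v :
  iter k (sigma i \o sigma j) (a *: u + v) =
  a *: iter k (sigma i \o sigma j) u + iter k (sigma i \o sigma j) v.
Proof.
by elim: k => //= k ->; rewrite [sigma j _]sigmaD sigmaZ [sigma i _]sigmaD sigmaZ.
Qed.

Lemma iter_sigmaK i j k :
  cancel (iter k (sigma i \o sigma j)) (iter k (sigma j \o sigma i)).
Proof. by elim: k => // k IHk v; rewrite iterSr /= !sigmaK IHk. Qed.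

(* The plane of alpha_i and alpha_j is nondegenerate, since the order of s_i s_j
   is finite; it has an orthogonal complement, which is fixed. *)
Lemma iter_order i j v : iter #[s i * s j]%g (sigma i \o sigma j) v = v.
Proof.
have [<-|neq_ij] := eqVneq i j.
  by rewrite simple_eltK order1 /= sigmaK.
have fix_i := iter_order_root R neq_ij.
have fix_j : iter #[s i * s j]%g (sigma i \o sigma j) (root j) = root j.
  rewrite eq_sym in neq_ij; have := iter_order_root R neq_ij.
  by rewrite order_sC => {1}<-; rewrite iter_sigmaK.
have sin_n0 := lt0r_neq0 (sin_angle_gt0 R neq_ij).
have := cos2Dsin2 (angle R i j); set c := cos _; set si := sin _ => cs1.
have eB : B (root i) (root j) = - c by rewrite form_simple.
(* The coefficients solve the Gram system with off-diagonal entry [- c] and determinant [si ^+ 2],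
   so that [v'] is orthogonal to both roots. *)
pose x := (B v (root i) + c * B v (root j)) / si ^+ 2.
pose y := (B v (root j) + c * B v (root i)) / si ^+ 2.
pose v' := v - x *: root i - y *: root j.
have si2 : si ^+ 2 = 1 - c ^+ 2 by rewrite -cs1 addrC addKr.
have d_n0 : 1 - c ^+ 2 != 0 by rewrite -si2 expf_neq0.
have orth_i : B (root i) v' = 0.
  rewrite /v' !formE form_simple1 eB /x /y si2 (formC _ v); field; exact: d_n0.
have orth_j : B (root j) v' = 0.
  rewrite /v' !formE form_simple1 (formC _ (root i)) eB /x /y si2 (formC _ v).
  by field; exact: d_n0.
have fix_v' k : iter k (sigma i \o sigma j) v' = v'.
  elim: k => //= k ->; rewrite /simple_reflection orth_j mulr0 scale0r subr0.
  by rewrite orth_i mulr0 scale0r subr0.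
have -> : v = x *: root i + (y *: root j + v').
  by rewrite /v'; move: (root i) (root j) => a b; apply/rowP=> k; rewrite !mxE; ring.
by rewrite !iter_sigma_lin fix_i fix_j fix_v'.
Qed.

Definition refl_gl i : gl R n := GL (refl_mx_unit R i).

(** [coxeter_presentation] takes a function on the whole group; off the generators the value [1] is
    a dummy. *)
Definition gen_gl (x : C) : gl R n :=
  if [pick i | s i == x] is Some i then refl_gl i else 1%g.

Lemma gen_gl_simple i : gen_gl (s i) = refl_gl i.
Proof.
rewrite /gen_gl; case: pickP => [k /eqP/simple_elt_inj -> //|/(_ i)].
by rewrite eqxx.
Qed.

Lemma refl_gl_expE i j k v :
  v *m (gl_val ((refl_gl i * refl_gl j) ^+ k)%g) =
  iter k (sigma j \o sigma i) v.
Proof.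
elim: k v => [|k IHk] v; first exact: mulmx1.
by rewrite expgSr iterS /= -IHk !simple_reflectionE -!mulmxA.
Qed.

Lemma representation_exists :
  exists phi : {multiplicative C -> gl R n}, forall i, phi (s i) = refl_gl i.
Proof.
have [x y xS yS|phi phiS] := @simple_presents C (gl R n) gen_gl.
  rewrite -(enum_rankK_in xS xS) -(enum_rankK_in yS yS).
  rewrite -!/(s _) !gen_gl_simple; apply: val_inj.
  apply/row_matrixP => k; rewrite !rowE refl_gl_expE order_sC iter_order.
  by rewrite [1%g]/(gl_one R n) /= mulmx1.
by exists phi => i; rewrite phiS ?simple_elt_in // gen_gl_simple.
Qed.

Lemma multiplicative1 (G H : groupType) (phi : {multiplicative G -> H}) :
  phi 1%g = 1%g.
Proof. by apply: (mulIg (phi 1%g)); rewrite -gmulfM !mul1g. Qed.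

Lemma geom_act_word (phi : {multiplicative C -> gl R n}) (c : seq 'I_n) v :
  (forall i, phi (s i) = refl_gl i) ->
  foldr sigma v c = v *m gl_val (phi (word_prod c)^-1%g).
Proof.
move=> phiS; elim: c v => [|i c IHc] v /=.
  by rewrite /word_prod big_nil invg1 multiplicative1 mulmx1.
rewrite IHc /word_prod big_cons invMg gmulfM simple_eltV phiS /=.
by rewrite mulmxA simple_reflectionE.
Qed.

(** Matrices act on rows from the right; composing [phi] with inversion gives a left action, hence
    the reversed product. As [phi] sees only the group element, the choice made by [some_word] does
    not matter. *)
Lemma geom_act_mx :
  exists A : C -> 'M[R]_n,
    [/\ forall w v, geom_act w v = v *m A w,
        forall w w', A (w * w')%g = A w' *m A w,
        A 1%g = 1%:M & forall i v, v *m A (s i) = sigma i v].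
Proof.
have [phi phiS] := representation_exists.
exists (fun w => gl_val (phi w^-1%g)); split => [w v|w w'||i v].
- rewrite /geom_act (geom_act_word _ _ phiS).
  by rewrite (eqP (xchooseP (word_exists w))).
- by rewrite invMg gmulfM.
- by rewrite invg1 multiplicative1.
- by rewrite simple_eltV phiS simple_reflectionE.
Qed.

Lemma geom_actM w w' v : geom_act (w * w')%g v = geom_act w (geom_act w' v).
Proof. by have [A [E M _ _]] := geom_act_mx; rewrite !E M mulmxA. Qed.
Lemma geom_act1 v : geom_act (1%g : C) v = v.
Proof. by have [A [E _ A1 _]] := geom_act_mx; rewrite !E A1 mulmx1. Qed.
Lemma geom_act_simple i v : geom_act (s i) v = sigma i v.
Proof. by have [A [E _ _ As]] := geom_act_mx; rewrite !E As. Qed.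
Lemma geom_actD w u v : geom_act w (u + v) = geom_act w u + geom_act w v.
Proof. by have [A [E _ _ _]] := geom_act_mx; rewrite !E mulmxDl. Qed.
Lemma geom_actZ w a v : geom_act w (a *: v) = a *: geom_act w v.
Proof. by have [A [E _ _ _]] := geom_act_mx; rewrite !E scalemxAl. Qed.
Lemma geom_actN w v : geom_act w (- v) = - geom_act w v.
Proof. by rewrite -scaleN1r geom_actZ scaleN1r. Qed.
Lemma geom_actB w u v : geom_act w (u - v) = geom_act w u - geom_act w v.
Proof. by rewrite geom_actD geom_actN. Qed.
Lemma geom_actK w : cancel (@geom_act R C w) (geom_act w^-1%g).
Proof. by move=> v; rewrite -geom_actM mulVg geom_act1. Qed.
Lemma geom_actKV w : cancel (@geom_act R C w^-1%g) (geom_act w).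
Proof. by move=> v; rewrite -geom_actM mulgV geom_act1. Qed.

Lemma form_geom_act w u v : B (geom_act w u) (geom_act w v) = B u v.
Proof.
rewrite /geom_act; elim: (some_word w) => //= i c <-.
by rewrite form_sigma.
Qed.

End Representation.

(** * Lengths and roots *)

Section Length.
Variable C : coxeterSystem.
Local Notation n := (rank C).
Local Notation s := (@simple_elt C).
Local Notation len := (@cox_length C).
Implicit Types (i j : 'I_n) (w : C) (c : seq 'I_n).

Lemma word_prod_cat c c' : word_prod (c ++ c') = (word_prod c * word_prod c')%g.
Proof. by rewrite /word_prod big_cat. Qed.

Lemma word_prod_cons i c : word_prod (i :: c) = (s i * word_prod c)%g.
Proof. by rewrite /word_prod big_cons. Qed.

Lemma word_prod_rcons c i : word_prod (rcons c i) = (word_prod c * s i)%g.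
Proof. by rewrite -cats1 word_prod_cat /word_prod big_seq1. Qed.

Lemma word_prod_rev c : word_prod (rev c) = (word_prod c)^-1%g.
Proof.
elim: c => [|i c IHc]; first by rewrite /word_prod big_nil invg1.
by rewrite rev_cons word_prod_rcons IHc word_prod_cons invMg simple_eltV.
Qed.

Lemma reduced_word w : exists2 c, word_prod c = w & size c = len w.
Proof.
rewrite /cox_length; case: ex_minnP => k /existsP[c /eqP cw] _.
by exists c; rewrite ?size_tuple.
Qed.

Lemma cox_length_word c : (len (word_prod c) <= size c)%N.
Proof.
rewrite /cox_length; case: ex_minnP => k _; apply.
by apply/existsP; exists (in_tuple c).
Qed.

Lemma cox_length1 : len 1%g = 0%N.
Proof.
by apply/eqP; have := cox_length_word [::]; rewrite /word_prod big_nil leqn0.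
Qed.

Lemma cox_length_eq0 w : (len w == 0%N) = (w == 1%g).
Proof.
apply/eqP/eqP => [|->]; last exact: cox_length1.
have [c <- <-] := reduced_word w; move/size0nil ->.
by rewrite /word_prod big_nil.
Qed.

Lemma cox_length_mul w w' : (len (w * w')%g <= len w + len w')%N.
Proof.
have [c cw <-] := reduced_word w; have [c' cw' <-] := reduced_word w'.
by rewrite -cw -cw' -word_prod_cat -size_cat cox_length_word.
Qed.

Lemma cox_length_simple i : (len (s i) <= 1)%N.
Proof. by have := cox_length_word [:: i]; rewrite /word_prod big_seq1. Qed.

Lemma cox_length_mulr w i : (len (w * s i)%g <= (len w).+1)%N.
Proof.
by rewrite -addn1 (leq_trans (cox_length_mul _ _)) // leq_add2l cox_length_simple.
Qed.

Lemma cox_length_mull w i : (len (s i * w)%g <= (len w).+1)%N.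
Proof.
by rewrite -add1n (leq_trans (cox_length_mul _ _)) // leq_add2r cox_length_simple.
Qed.

Lemma cox_lengthV w : len w^-1%g = len w.
Proof.
suff le_len x : (len x^-1%g <= len x)%N.
  by apply/eqP; rewrite eqn_leq le_len -{1}(invgK w) le_len.
have [c cx <-] := reduced_word x.
by rewrite -cx -word_prod_rev -(size_rev c) cox_length_word.
Qed.

Lemma mul_simpleK w i : (w * s i * s i = w)%g.
Proof. by rewrite -mulgA simple_eltK mulg1. Qed.

Lemma right_descent w : w != 1%g -> exists i, len w = (len (w * s i)%g).+1.
Proof.
rewrite -cox_length_eq0 -lt0n; have [c cw szc] := reduced_word w.
case/lastP: c cw szc => [_ <- //|c i].
rewrite word_prod_rcons size_rcons => cw szc _; exists i.
apply/eqP; rewrite eqn_leq; apply/andP; split.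
  by rewrite -{1}(mul_simpleK w i) cox_length_mulr.
by rewrite -szc ltnS -cw mul_simpleK cox_length_word.
Qed.

Fixpoint alt_prod i j (q : nat) : C :=
  if q is q'.+1 then (s (alt_letter i j q') * alt_prod i j q')%g else 1%g.

Lemma alt_prod_double i j k : alt_prod i j k.*2 = ((s i * s j) ^+ k)%g.
Proof.
elim: k => //= k ->.
by rewrite expgS /alt_letter /= !odd_double mulgA.
Qed.

(** Bringing both sides together leaves [(s i * s j) ^+ m = 1] with [m] the order; the two cases are
    the parities of [m]. *)
Lemma braid i j : alt_prod i j #[s i * s j]%g = alt_prod j i #[s i * s j]%g.
Proof.
have rV : ((s j * s i) = (s i * s j)^-1)%g by rewrite invMg !simple_eltV.
have rm := expg_order (s i * s j)%g.
move: rm; rewrite -(odd_double_half #[s i * s j]%g).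
move: (odd _) (half _) => [] k rm.
  rewrite add1n in rm *; rewrite /= !alt_prod_double /alt_letter !odd_double rV expgVn.
  apply: (mulgI (s i)); rewrite !mulgA simple_eltK mul1g -expgS.
  by apply/eqP; rewrite eq_sym eq_invg_mul -expgD addnS addnn; apply/eqP.
rewrite add0n in rm *; rewrite !alt_prod_double rV expgVn.
by apply/eqP; rewrite eq_sym eq_invg_mul -expgD addnn; apply/eqP.
Qed.

Lemma cox_length_alt i j q : (len (alt_prod i j q) <= q)%N.
Proof.
elim: q => [|q IHq]; first by rewrite /= cox_length1.
exact: leq_trans (cox_length_mull _ _) _.
Qed.

Lemma cox_length_alt_last i j q : (len (alt_prod j i q.+1 * s i)%g <= q)%N.
Proof.
elim: q => [|q IHq]; first by rewrite /= mulg1 /alt_letter /= simple_eltK cox_length1.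
rewrite -[alt_prod _ _ _]/(s _ * alt_prod j i q.+1)%g -mulgA.
exact: leq_trans (cox_length_mull _ _) _.
Qed.

(** By [braid], the alternating word of [m] letters can also be written with last letter [s i],
    which cancels; further letters on the left add at most one each. *)
Lemma cox_length_alt_long i j q :
  (#[s i * s j]%g <= q)%N -> (len (alt_prod i j q * s i)%g < q)%N.
Proof.
elim: q => [|q IHq]; first by rewrite leqNgt order_gt0.
rewrite leq_eqVlt => /orP[/eqP mq|lt_mq].
  by rewrite -mq braid mq ltnS cox_length_alt_last.
rewrite [alt_prod _ _ _]/= -mulgA ltnS (leq_trans (cox_length_mull _ _)) //.
exact: IHq.
Qed.

(* Stripping letters s_j, s_i, s_j, ... from the right of w as long as the
   length drops. *)
Lemma alt_factorization w i j :
  (len (w * s j)%g < len w)%N ->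
  exists v q,
    [/\ (0 < q)%N, w = (v * alt_prod i j q)%g, len w = (len v + q)%N,
        (len v <= len (v * s (alt_letter i j q))%g)%N &
        (len v <= len (v * s (alt_letter i j q.+1))%g)%N].
Proof.
move=> desc_j.
have lwj : len w = (len (w * s j)%g).+1.
  by apply/eqP; rewrite eqn_leq desc_j -{1}(mul_simpleK w j) cox_length_mulr.
suff strip k q v : (len w - q < k)%N -> (0 < q)%N ->
    w = (v * alt_prod i j q)%g -> len w = (len v + q)%N ->
    exists v' q',
    [/\ (0 < q')%N, w = (v' * alt_prod i j q')%g, len w = (len v' + q')%N,
        (len v' <= len (v' * s (alt_letter i j q'))%g)%N &
        (len v' <= len (v' * s (alt_letter i j q'.+1))%g)%N].
  apply: (strip _ 1%N (w * s j)%g (ltnSn _)); rewrite ?lwj ?addn1 //.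
  by rewrite /= /alt_letter mulg1 mul_simpleK.
elim: k q v => // k IHk q v lt_k q_gt0 wE lw.
have [le_v|lt_v] := leqP (len v) (len (v * s (alt_letter i j q))%g).
  exists v, q; split=> //; case: q q_gt0 wE lw {lt_k le_v} => // q _ wE lw.
  (* [w] is [v * s (alt_letter i j q)] times an alternating word of [q] letters, so that product
     cannot be shorter than [v]. *)
  rewrite alt_letterSS -(leq_add2r q.+1) -lw addnS -ltnS -addSn addnC.
  have := cox_length_mul (v * s (alt_letter i j q))%g (alt_prod i j q).
  rewrite -mulgA -[(s _ * _)%g]/(alt_prod i j q.+1) -wE.
  by have := cox_length_alt i j q; lia.
have lvE : len v = (len (v * s (alt_letter i j q))%g).+1.
  by apply/eqP; rewrite eqn_leq lt_v -{1}(mul_simpleK v (alt_letter i j q)) cox_length_mulr.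
apply: (IHk q.+1 (v * s (alt_letter i j q))%g) => //; try lia.
by rewrite /= mulgA mul_simpleK.
Qed.

End Length.

(** * Signs of roots, reflections and their effect on length *)

Section Roots.
Variables (R : realType) (C : coxeterSystem).
Local Notation n := (rank C).
Local Notation V := 'rV[R]_n.
Local Notation simple := (@simple_root R C).
Local Notation s := (@simple_elt C).
Local Notation B := (@form R C).
Local Notation len := (@cox_length C).
Local Notation act := (@geom_act R C).
Local Notation root := (@roots R C).
Local Notation refl := (@root_reflection R C).
Implicit Types (i j : 'I_n) (a b u v : V) (w : C).

Lemma geom_act_alt i j q v : act (alt_prod i j q) v = alt_act i j q v.
Proof.
elim: q => [|q IHq] /=; first exact: geom_act1.
by rewrite geom_actM geom_act_simple IHq.
Qed.

(** Induction on length. A right descent [s j] gives [w = v * alt_prod i j q] with [v] shorter and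
    ascending at both letters. By [alt_act_root] the root is, up to scale, a combination of the
    images of [simple i] and [simple j] under [v]; the coefficients are nonnegative because the
    ascent at [s i] forces [q < m]. *)
Lemma geom_act_simple_ge0 w i :
  (len w <= len (w * s i)%g)%N -> forall k, 0 <= act w (simple i) 0 k.
Proof.
have [l] := ubnP (len w); elim: l w i => // l IHl w i lt_l asc_i k.
have [->|w_n1] := eqVneq w 1%g.
  by rewrite geom_act1 /simple_root !mxE /=; case: eqP.
have [j lwj] := right_descent w_n1.
have desc_j : (len (w * s j)%g < len w)%N by rewrite lwj.
have neq_ij : i != j.
  by apply: contraTneq desc_j => <-; rewrite -leqNgt.
have [v [q [q_gt0 wE lw asc1 asc2]]] := alt_factorization i desc_j.
have lt_v : (len v < l)%N by lia.
have lt_q : (q < #[s i * s j]%g)%N.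
  rewrite ltnNge; apply/negP => /cox_length_alt_long ltq.
  have := cox_length_mul v (alt_prod i j q * s i)%g.
  rewrite mulgA -wE => /(leq_trans asc_i).
  by rewrite lw leqNgt ltn_add2l ltq.
have sin_gt0 := sin_angle_gt0 R neq_ij.
rewrite -(pmulr_rge0 _ sin_gt0).
have -> : sin (angle R i j) * act w (simple i) 0 k =
          (sin (angle R i j) *: act w (simple i)) 0 k by rewrite mxE.
rewrite wE geom_actM geom_act_alt -geom_actZ alt_act_root geom_actD !geom_actZ !mxE.
by rewrite addr_ge0 // mulr_ge0 ?IHl ?sin_angle_ge0 // ltnW.
Qed.

(** A linear functional that vanishes on no root, so that its sign alone tells positive roots from
    negative ones. *)
Definition height v : R := \sum_k v 0 k.

Lemma heightD u v : height (u + v) = height u + height v.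
Proof. by rewrite -big_split; apply: eq_bigr => k _; rewrite mxE. Qed.
Lemma heightZ x v : height (x *: v) = x * height v.
Proof. by rewrite mulr_sumr; apply: eq_bigr => k _; rewrite mxE. Qed.
Lemma heightN v : height (- v) = - height v.
Proof. by rewrite -scaleN1r heightZ mulN1r. Qed.

Lemma height_ge0_gt0 v :
  v != 0 -> (forall k, 0 <= v 0 k) -> 0 < height v.
Proof.
move=> v_n0 v_ge0; rewrite lt_def sumr_ge0 // andbT.
apply: contra v_n0; rewrite psumr_eq0 // => /allP v0.
by apply/eqP/rowP => k; rewrite mxE; apply/eqP/v0; rewrite mem_index_enum.
Qed.

Lemma form_root a : root a -> B a a = 1.
Proof. by case=> [w [i ->]]; rewrite form_geom_act form_simple1. Qed.

Lemma root_neq0 a : root a -> a != 0.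
Proof.
move/form_root => aa1; apply: contra_eq_neq aa1 => ->.
by rewrite -(scale0r 0) formZl mul0r eq_sym oner_neq0.
Qed.

Lemma root_simple i : root (simple i).
Proof. by exists 1%g, i; rewrite geom_act1. Qed.

Lemma root_act w a : root a -> root (act w a).
Proof. by case=> [w' [i ->]]; exists (w * w')%g, i; rewrite geom_actM. Qed.

Lemma geom_act_simple_self w i : act (w * s i)%g (simple i) = - act w (simple i).
Proof.
rewrite geom_actM geom_act_simple /simple_reflection form_simple1 -geom_actN.
congr (act w _); apply/rowP => k; rewrite !mxE; ring.
Qed.

Lemma rootN a : root a -> root (- a).
Proof. by case=> [w [i ->]]; exists (w * s i)%g, i; rewrite geom_act_simple_self. Qed.

Lemma height_simple_gt0 w i :
  (len w <= len (w * s i)%g)%N -> 0 < height (act w (simple i)).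
Proof.
move=> asc; apply: height_ge0_gt0 (geom_act_simple_ge0 asc).
by apply/root_neq0/root_act/root_simple.
Qed.

Lemma height_simple_lt0 w i :
  (len (w * s i)%g <= len w)%N -> height (act w (simple i)) < 0.
Proof.
move=> desc; rewrite -oppr_gt0 -heightN -geom_act_simple_self.
by apply: height_simple_gt0; rewrite mul_simpleK.
Qed.

Lemma root_sign a : root a ->
  (0 < height a /\ forall k, 0 <= a 0 k) \/
  (height a < 0 /\ forall k, a 0 k <= 0).
Proof.
case=> [w [i ->]]; have [asc|desc] := leqP (len w) (len (w * s i)%g).
  by left; split; [exact: height_simple_gt0|exact: geom_act_simple_ge0].
right; split=> [|k]; first exact/height_simple_lt0/ltnW.
rewrite -oppr_ge0; have := @geom_act_simple_ge0 (w * s i)%g i.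
by rewrite mul_simpleK geom_act_simple_self => /(_ (ltnW desc) k); rewrite mxE.
Qed.

Lemma root_height_neq0 a : root a -> height a != 0.
Proof. by move=> /root_sign[[/gt_eqF-> _]|[/lt_eqF-> _]]. Qed.

Lemma root_height_le0 a : root a -> height a <= 0 -> height a < 0.
Proof. by move=> /root_height_neq0 a0; rewrite lt_neqAle a0. Qed.

Lemma root_height_ge0 a : root a -> 0 <= height a -> 0 < height a.
Proof. by move=> /root_height_neq0 a0; rewrite lt_neqAle eq_sym a0. Qed.

Lemma positive_rootsE a : positive_roots a <-> root a /\ 0 < height a.
Proof.
split=> [[ra a_ge0]|[ra a_gt0]]; split=> //.
  exact: height_ge0_gt0 (root_neq0 ra) a_ge0.
by case: (root_sign ra) => [[]//|[a_lt0 _]]; rewrite lt_gtF in a_gt0.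
Qed.

Lemma inversionsE w a :
  inversions R w a <-> [/\ root a, 0 < height a & height (act w^-1%g a) < 0].
Proof.
split=> [[/positive_rootsE[ra a_gt0] [_ [b /positive_rootsE[rb b_gt0] <-] ba]]|].
  by split=> //; rewrite -ba geom_actK heightN oppr_lt0.
move=> [ra a_gt0 wa_lt0]; split; first exact/positive_rootsE.
exists (act w^-1%g a); last exact: geom_actKV.
exists (- act w^-1%g a); last exact: opprK.
apply/positive_rootsE; split; first exact/rootN/root_act.
by rewrite heightN oppr_gt0.
Qed.

Lemma geom_act_faithful w : (forall v, act w v = v) -> w = 1%g.
Proof.
move=> w1; apply/eqP; apply: contraT => /right_descent[i lw].
have := @height_simple_lt0 w i; rewrite lw leqnSn w1 => /(_ isT).
have := @height_simple_gt0 1%g i; rewrite cox_length1 geom_act1 => /(_ isT).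
by move=> /lt_gtF ->.
Qed.

Lemma geom_act_inj w w' : (forall v, act w v = act w' v) -> w = w'.
Proof.
move=> ww'; apply: (mulIg w'^-1%g); rewrite mulgV.
by apply: geom_act_faithful => v; rewrite geom_actM ww' geom_actKV.
Qed.

(** Whichever pair [xget] selects, conjugating the simple reflection gives the orthogonal reflection
    in [a]. *)
Lemma geom_act_refl a v : root a -> act (refl a) v = v - (2 * B a v) *: a.
Proof.
move=> [w [i aE]]; rewrite /root_reflection.
case: xgetP => [t _ [w' [j [-> ->]]]|/(_ (w * s i * w^-1)%g) []]; last by exists w, i.
rewrite !geom_actM geom_act_simple /simple_reflection geom_actB geom_actKV geom_actZ.
by rewrite -(form_geom_act w' _ (act w'^-1%g v)) geom_actKV.
Qed.

Lemma refl_act w a : root a -> refl (act w a) = (w * refl a * w^-1)%g.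
Proof.
move=> ra; apply: geom_act_inj => v; rewrite geom_act_refl; last exact: root_act.
rewrite !geom_actM geom_act_refl // geom_actB geom_actKV geom_actZ.
by rewrite -(form_geom_act w _ (act w^-1%g v)) geom_actKV.
Qed.

Lemma refl_simple i : refl (simple i) = s i.
Proof.
apply: geom_act_inj => v; rewrite geom_act_refl ?geom_act_simple //.
exact: root_simple.
Qed.

Lemma refl_opp a : root a -> refl (- a) = refl a.
Proof.
move=> ra; apply: geom_act_inj => v; rewrite !geom_act_refl //; last exact: rootN.
by rewrite formNl mulrN scaleNr scalerN opprK.
Qed.

Lemma geom_act_refl_self a : root a -> act (refl a) a = - a.
Proof.
move=> ra; rewrite geom_act_refl // form_root //.
by apply/rowP => k; rewrite !mxE; ring.
Qed.

Lemma reflK a : root a -> (refl a * refl a = 1)%g.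
Proof.
move=> ra; apply: geom_act_faithful => v; rewrite geom_actM !geom_act_refl //.
rewrite !formE form_root //; move: (B a v) => x.
by apply/rowP => k; rewrite !mxE; ring.
Qed.

Lemma reflV a : root a -> ((refl a)^-1 = refl a)%g.
Proof. by move=> ra; apply/eqP; rewrite eq_invg_mul reflK. Qed.

Lemma refl_mulK w a : root a -> (w * refl a * refl a = w)%g.
Proof. by move=> ra; rewrite -mulgA reflK // mulg1. Qed.

(** [s i] changes only coordinate [i], so the other coordinates of [a] vanish; [B a a = 1] fixes the
    remaining one. *)
Lemma simple_permutes_positive i a :
  root a -> 0 < height a -> height (act (s i) a) < 0 -> a = simple i.
Proof.
move=> ra a_gt0 sa_lt0.
have a_ge0 : forall k, 0 <= a 0 k.
  by case: (root_sign ra) => [[]//|[]]; rewrite ltNge ltW.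
have sa_le0 : forall k, act (s i) a 0 k <= 0.
  by case: (root_sign (root_act (s i) ra)) => [[]|[]//]; rewrite ltNge ltW.
have aE : a = a 0 i *: simple i.
  apply/rowP => k; rewrite /simple_root !mxE eqxx /=.
  have [->|neq_ki] := eqVneq k i; first by rewrite mulr1.
  apply/eqP; rewrite mulr0 eq_le a_ge0 andbT; have := sa_le0 k.
  rewrite geom_act_simple /simple_reflection /simple_root !mxE eqxx /=.
  by rewrite (negbTE neq_ki) mulr0 subr0.
have : a 0 i ^+ 2 = 1.
  have BZ x : B (x *: simple i) (x *: simple i) = x ^+ 2.
    by rewrite formZl formZr form_simple1 mulr1.
  by rewrite -BZ -aE form_root.
move/eqP; rewrite sqrp_eq1 ?a_ge0 // => /eqP ai1.
by rewrite aE ai1 scale1r.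
Qed.

(** Stripping a right descent [s j] of [w] carries the claim to [w * s j] and [act (s j) a], unless
    [a] is [simple j], where the reflection is the descent itself. *)
Lemma length_refl_lt w a :
  root a -> 0 < height a -> height (act w a) < 0 ->
  (len (w * refl a)%g < len w)%N.
Proof.
have [l] := ubnP (len w); elim: l w a => // l IHl w a lt_l ra a_gt0 wa_lt0.
have [w1|/right_descent[j lw]] := eqVneq w 1%g.
  by move: wa_lt0; rewrite w1 geom_act1 lt_gtF.
have [sa_lt0|sa_ge0] := ltP (height (act (s j) a)) 0.
  by rewrite (simple_permutes_positive ra a_gt0 sa_lt0) refl_simple lw.
have rsa := root_act (s j) ra.
have := IHl (w * s j)%g (act (s j) a).
rewrite -geom_actM mul_simpleK refl_act // simple_eltV => /(_ _ rsa _ wa_lt0).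
have -> : (w * s j * (s j * refl a * s j) = w * refl a * s j)%g.
  by rewrite !mulgA mul_simpleK.
move=> lt_j; apply: leq_ltn_trans (_ : (len (w * refl a * s j)%g).+1 < _)%N.
  by rewrite -{1}(mul_simpleK (w * refl a)%g j) cox_length_mulr.
by rewrite lw ltnS lt_j ?root_height_ge0 // -ltnS -lw.
Qed.

Lemma length_refl_gt w a :
  root a -> 0 < height a -> 0 < height (act w a) ->
  (len w < len (w * refl a)%g)%N.
Proof.
move=> ra a_gt0 wa_gt0; rewrite -{1}(refl_mulK w ra); apply: length_refl_lt => //.
by rewrite geom_actM geom_act_refl_self // geom_actN heightN oppr_lt0.
Qed.

Lemma length_refl_lt_inv w a :
  root a -> 0 < height a -> (len (w * refl a)%g <= len w)%N ->
  height (act w a) < 0.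
Proof.
move=> ra a_gt0 le_len; apply: root_height_le0 (root_act w ra) _.
by rewrite leNgt; apply/negP => /(length_refl_gt ra a_gt0); rewrite ltnNge le_len.
Qed.

End Roots.

(** * Inversion sets *)

Section Inversions.
Variables (R : realType) (C : coxeterSystem).
Local Notation n := (rank C).
Local Notation V := 'rV[R]_n.
Local Notation simple := (@simple_root R C).
Local Notation s := (@simple_elt C).
Local Notation B := (@form R C).
Local Notation len := (@cox_length C).
Local Notation act := (@geom_act R C).
Local Notation root := (@roots R C).
Local Notation refl := (@root_reflection R C).
Local Notation ht := (@height R C).
Local Notation inv := (@inversions R C).
Implicit Types (i j r : 'I_n) (a b : V) (c g k u w x y z : C).

Lemma invI w a : root a -> 0 < ht a -> ht (act w^-1%g a) < 0 -> inv w a.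
Proof. by move=> *; apply/inversionsE. Qed.

Lemma inv_root w a : inv w a -> root a.
Proof. by case/inversionsE. Qed.
Lemma inv_gt0 w a : inv w a -> 0 < ht a.
Proof. by case/inversionsE. Qed.
Lemma inv_lt0 w a : inv w a -> ht (act w^-1%g a) < 0.
Proof. by case/inversionsE. Qed.

Lemma notinv_gt0 w a :
  root a -> 0 < ht a -> ~ inv w a -> 0 < ht (act w^-1%g a).
Proof.
move=> ra a_gt0 ninv; apply: root_height_ge0 (root_act _ ra) _.
by rewrite leNgt; apply/negP => /(invI ra a_gt0).
Qed.

Lemma simple_gt0 i : 0 < ht (simple i).
Proof.
have := @height_simple_gt0 R C 1%g i; rewrite cox_length1 geom_act1.
exact.
Qed.

Lemma act_inv_simple w i : act (w * s i)^-1%g = act (s i) \o act w^-1%g.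
Proof. by apply/funext => v; rewrite invMg simple_eltV geom_actM. Qed.

Lemma simple_pos_or_eq i a :
  root a -> 0 < ht a -> a != simple i -> 0 < ht (act (s i) a).
Proof.
move=> ra a_gt0 a_n; apply: root_height_ge0 (root_act _ ra) _.
by rewrite leNgt; apply: contra a_n => /(simple_permutes_positive ra a_gt0)->.
Qed.

Lemma inv_mulr w i a :
  inv w a -> act w^-1%g a <> - simple i -> inv (w * s i)%g a.
Proof.
case/inversionsE=> ra a_gt0 wa_lt0 neq; apply: invI => //.
rewrite act_inv_simple /= -oppr_gt0 -heightN -geom_actN.
apply: simple_pos_or_eq; first exact/rootN/root_act.
  by rewrite heightN oppr_gt0.
by apply/eqP => /(congr1 -%R); rewrite opprK.
Qed.

Lemma inv_mull w j a :
  0 < ht (act w^-1%g (simple j)) -> inv w a -> inv (s j * w)%g (act (s j) a).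
Proof.
move=> wj_gt0 /inversionsE[ra a_gt0 wa_lt0]; apply: invI.
- exact: root_act.
- apply: simple_pos_or_eq => //; apply: contraTneq wa_lt0 => ->.
  by rewrite -leNgt ltW.
- by rewrite -geom_actM invMg simple_eltV mul_simpleK.
Qed.

Lemma left_descent w : w != 1%g ->
  exists2 j, len w = (len (s j * w)%g).+1 & inv w (simple j).
Proof.
rewrite -(inj_eq invg_inj) invg1 => /right_descent[j].
rewrite -(cox_lengthV (_ * _)%g) invMg simple_eltV invgK cox_lengthV => lw.
exists j => //; apply: invI (root_simple _ j) (simple_gt0 j) _.
apply: height_simple_lt0; rewrite -(cox_lengthV (_ * _)%g) invMg simple_eltV invgK.
by rewrite cox_lengthV lw.
Qed.

(** The ratio of [ht (act x^-1 a)] to [- ht (act c^-1 a)] grows with the point where the segment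
    from [x] to [c] crosses the wall of [a]. The finite type [C * 'I_n] parametrizes the roots, so a
    maximum exists. *)
Lemma exists_ratio_max (x c : C) :
  (exists a, inv c a /\ ~ inv x a) ->
  exists t, [/\ inv c t, ~ inv x t & forall a, inv c a -> ~ inv x a ->
    ht (act x^-1%g a) * - ht (act c^-1%g t) <=
    ht (act x^-1%g t) * - ht (act c^-1%g a)].
Proof.
pose f (p : C * 'I_n) := act p.1 (simple p.2).
pose P (p : C * 'I_n) := `[< inv c (f p) /\ ~ inv x (f p) >].
pose F (p : C * 'I_n) := ht (act x^-1%g (f p)) / - ht (act c^-1%g (f p)).
move=> [a [ca xa]]; have [w0 [i0 aE]] := inv_root ca.
have P0 : P (w0, i0) by apply/asboolP; rewrite /f /= -aE.
have [p /asboolP[cp xp] pmax] := @arg_maxP _ _ _ (w0, i0) P F P0.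
exists (f p); split=> // b cb xb; have [w [i bE]] := inv_root cb.
have fb : f (w, i) = b by rewrite bE.
have /pmax : P (w, i) by apply/asboolP; rewrite fb.
have := inv_lt0 cb; have := inv_lt0 cp; rewrite /F fb.
rewrite -!oppr_gt0 => cp0 cb0 /=.
by rewrite ler_pdivrMr // mulrAC ler_pdivlMr.
Qed.

(* Among the roots t separating c from both 1 and x, take the one whose wall is
   crossed last on the segment from x to c; then s_t c is shorter than c and all
   its inversions are inversions of c or of x. *)
Lemma minimal_escape c g k x b :
  inv c `<=` inv g ->
  (forall y, inv y `<=` inv g -> (len y < len c)%N -> inv y `<=` inv k) ->
  inv c b -> ~ inv k b -> (forall a, inv c a -> a <> b -> inv k a) ->
  inv x `<=` inv g -> inv x b -> inv c `<=` inv x.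
Proof.
move=> c_g short_k cb kb c_k x_g xb a0 ca0; apply: contrapT => xa0.
have [t [ct xt tmax]] := exists_ratio_max (ex_intro _ a0 (conj ca0 xa0)).
have /inversionsE[rt t_gt0 ct_lt0] := ct.
have xt_gt0 := notinv_gt0 rt t_gt0 xt.
have kt : inv k t by apply: c_k => // tb; case: xt; rewrite tb.
have hrefl w v : ht (act w^-1%g (act (refl t) v)) =
    ht (act w^-1%g v) - 2 * B t v * ht (act w^-1%g t).
  by rewrite geom_act_refl // geom_actB geom_actZ heightD heightN heightZ.
pose y := (refl t * c)%g.
have hy v : ht (act y^-1%g v) = ht (act c^-1%g (act (refl t) v)).
  by rewrite /y invMg reflV // geom_actM.
have y_short : (len y < len c)%N.
  rewrite -(cox_lengthV y) -(cox_lengthV c) /y invMg reflV //.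
  exact: length_refl_lt.
have y_g : inv y `<=` inv g.
  move=> a ya; have /inversionsE[ra a_gt0 ya_lt0] := ya.
  have [ca|ca] := pselect (inv c a); first exact: c_g.
  have [xa|xa] := pselect (inv x a); first exact: x_g.
  have ca_gt0 := notinv_gt0 ra a_gt0 ca; have xa_gt0 := notinv_gt0 ra a_gt0 xa.
  rewrite hy in ya_lt0.
  (* Reflecting [a] in [t] therefore adds a positive multiple of [t], and the result separates [c]
     from [x] with a larger ratio than [t]. *)
  have Bta : B t a < 0 by move: ya_lt0; rewrite hrefl; nra.
  have ma_gt0 : 0 < ht (act (refl t) a).
    by have := hrefl 1%g a; rewrite invg1 !geom_act1 => ->; nra.
  have rma : root (act (refl t) a) by exact: root_act.
  have cma := invI rma ma_gt0 ya_lt0.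
  have xma : ~ inv x (act (refl t) a).
    by move/inv_lt0; rewrite hrefl; nra.
  by have := tmax _ cma xma; rewrite !hrefl; nra.
have y_k := short_k y y_g y_short.
have /inversionsE[rb b_gt0 cb_lt0] := cb.
have xb_lt0 := inv_lt0 xb.
have yb_gt0 := notinv_gt0 rb b_gt0 (fun yb => kb (y_k b yb)).
have Btb : 0 < B t b by move: yb_gt0; rewrite hy hrefl; nra.
have rd : root (act (refl t) b) by exact: root_act.
have yd_lt0 : ht (act y^-1%g (act (refl t) b)) < 0.
  by rewrite hy -(geom_actM (refl t)) reflK // geom_act1.
(* If the reflected root is positive, [b] is a positive combination of it and [t], both inversions
   of [k]. If it is negative, its opposite has a larger ratio than [t]. *)
have [d_gt0|d_le0] := ltP 0 (ht (act (refl t) b)).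
  have kd_lt0 := inv_lt0 (y_k _ (invI rd d_gt0 yd_lt0)).
  apply: kb; apply: invI => //.
  by have := inv_lt0 kt; move: kd_lt0; rewrite hrefl; nra.
have e_gt0 : 0 < ht (- act (refl t) b).
  by rewrite heightN oppr_gt0 root_height_le0.
have ce : inv c (- act (refl t) b).
  apply: invI e_gt0 _; first exact: rootN.
  by rewrite geom_actN heightN -hy oppr_lt0.
have xe : ~ inv x (- act (refl t) b).
  by move/inv_lt0; rewrite geom_actN heightN hrefl; nra.
by have := tmax _ ce xe; rewrite !geom_actN !heightN !hrefl; nra.
Qed.

End Inversions.

(** * Bruhat order *)

Section Bruhat.
Variables (R : realType) (C : coxeterSystem).
Local Notation n := (rank C).
Local Notation V := 'rV[R]_n.
Local Notation simple := (@simple_root R C).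
Local Notation s := (@simple_elt C).
Local Notation len := (@cox_length C).
Local Notation act := (@geom_act R C).
Local Notation root := (@roots R C).
Local Notation refl := (@root_reflection R C).
Local Notation ht := (@height R C).
Local Notation inv := (@inversions R C).
Implicit Types (i j r : 'I_n) (a b : V) (c g k u v w x y z : C).

(** Positivity of [act y a] says that right multiplication by [refl a] lengthens [y]; one step may
    raise the length by more than one. *)
Inductive bruhat : C -> C -> Prop :=
| bruhat_refl y : bruhat y y
| bruhat_step y a w : root a -> 0 < ht a -> 0 < ht (act y a) ->
    bruhat (y * refl a)%g w -> bruhat y w.

Lemma bruhat_trans y w x : bruhat y w -> bruhat w x -> bruhat y x.
Proof.
elim=> // {}y a {}w ra a_gt0 ya_gt0 _ IH wx.
exact: bruhat_step ra a_gt0 ya_gt0 (IH wx).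
Qed.

Lemma bruhat_len y w : bruhat y w -> (len y <= len w)%N.
Proof.
elim=> // {}y a {}w ra a_gt0 ya_gt0 _; apply: leq_trans.
exact: ltnW (length_refl_gt _ _ _).
Qed.

Lemma bruhat_asc y j : 0 < ht (act y (simple j)) -> bruhat y (y * s j)%g.
Proof.
move=> asc; apply: (bruhat_step (root_simple R j) (simple_gt0 R j) asc).
by rewrite refl_simple; apply: bruhat_refl.
Qed.

Lemma act_mul_simple y j : ht (act (y * s j)%g (simple j)) = - ht (act y (simple j)).
Proof. by rewrite geom_act_simple_self heightN. Qed.

Lemma bruhat_desc y j : ht (act y (simple j)) < 0 -> bruhat (y * s j)%g y.
Proof.
move=> desc; rewrite -{2}(mul_simpleK y j); apply: bruhat_asc.
by rewrite act_mul_simple oppr_gt0.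
Qed.

Lemma bruhat_step_mulr y a j w :
  root a -> 0 < ht a -> a != simple j -> 0 < ht (act y a) ->
  bruhat (y * refl a * s j)%g w -> bruhat (y * s j)%g w.
Proof.
move=> ra a_gt0 a_n ya_gt0 le_w.
apply: (@bruhat_step _ (act (s j) a)); first exact: root_act.
- exact: simple_pos_or_eq.
- by rewrite -geom_actM mul_simpleK.
- by rewrite refl_act // simple_eltV !mulgA mul_simpleK.
Qed.

(** Translate the chain by [s j]; if one of its steps is [s j] itself, the translated chain meets
    the original there and follows it. *)
Lemma bruhat_mulr y w j :
  bruhat y w -> bruhat (y * s j)%g (w * s j)%g \/ bruhat (y * s j)%g w.
Proof.
elim=> [{}y|{}y a {}w ra a_gt0 ya_gt0 le_w IH]; first by left; apply: bruhat_refl.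
have [aE|a_n] := eqVneq a (simple j).
  by right; move: le_w; rewrite aE refl_simple.
by case: IH => IH; [left|right]; apply: bruhat_step_mulr IH.
Qed.

Lemma bruhat_mulr_asc y w j :
  bruhat y w -> 0 < ht (act w (simple j)) -> bruhat (y * s j)%g (w * s j)%g.
Proof.
move=> le_yw /bruhat_asc le_w; case: (bruhat_mulr j le_yw) => // le_y.
exact: bruhat_trans le_y le_w.
Qed.

Lemma bruhat_mulr_desc y w j :
  bruhat y w -> ht (act w (simple j)) < 0 -> bruhat (y * s j)%g w.
Proof.
move=> le_yw /bruhat_desc le_w; case: (bruhat_mulr j le_yw) => // le_y.
exact: bruhat_trans le_y le_w.
Qed.

Lemma bruhat_mulr_desc2 y w j :
  bruhat y w -> ht (act y (simple j)) < 0 -> bruhat (y * s j)%g (w * s j)%g.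
Proof.
move=> le_yw /bruhat_desc desc.
(* The disjunction passes along the chain, whereas a descent at [s j] need not. *)
suff [//|le_y] : bruhat (y * s j)%g (w * s j)%g \/ bruhat y (w * s j)%g.
  exact: bruhat_trans desc le_y.
elim: le_yw {desc} => [{}y|{}y a {}w ra a_gt0 ya_gt0 _ IH].
  by left; apply: bruhat_refl.
have [aE|a_n] := eqVneq a (simple j).
  rewrite aE refl_simple mul_simpleK in IH.
  case: IH => IH; first by right.
  by left.
case: IH => IH; first by left; apply: bruhat_step_mulr IH.
by right; apply: bruhat_step IH.
Qed.

Lemma inversions1 a : ~ inv 1%g a.
Proof. by move/inversionsE => [_ a_gt0]; rewrite invg1 geom_act1 lt_gtF. Qed.

Lemma inv_simpleV v j : inv v^-1%g (simple j) -> ht (act v (simple j)) < 0.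
Proof. by move/inv_lt0; rewrite invgK. Qed.

(* Descents common to y and v, read off a reduced word of z, reduce to the case
   where s_b is simple. *)
Lemma bruhat_reflection z y v r :
  bruhat y v -> 0 < ht (act z (simple r)) ->
  inv (z * s r)%g `<=` inv v^-1%g -> inv z `<=` inv y^-1%g ->
  bruhat (y * refl (act z (simple r)))%g v.
Proof.
have [l] := ubnP (len z); elim: l z y v => // l IHl z y v lt_l le_yv zr_gt0 zv zy.
have [z1|/(@left_descent R)[j lz zj]] := eqVneq z 1%g.
  move: zv; rewrite z1 mul1g geom_act1 refl_simple => zv.
  apply: bruhat_mulr_desc => //; apply/inv_simpleV/zv/invI.
  - exact: root_simple.
  - exact: simple_gt0.
  - by rewrite -[s r]mul1g act_inv_simple invg1 /= geom_act1 -[s r]mul1g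
      geom_act_simple_self geom_act1 heightN oppr_lt0 simple_gt0.
have zrj : inv (z * s r)%g (simple j).
  apply: inv_mulr => // /(congr1 (act z)); rewrite geom_actKV geom_actN => jE.
  by have := simple_gt0 R j; rewrite jE heightN oppr_gt0 lt_gtF.
have vj := inv_simpleV (zv _ zrj); have yj := inv_simpleV (zy _ zj).
(* Cancels a common left descent [s j]; this transports both inclusion hypotheses to [s j * z]. *)
have shift x x' : inv (s j * x)%g `<=` inv x'^-1%g ->
    inv (s j * x)%g (simple j) -> inv x `<=` inv (x' * s j)^-1%g.
  move=> xx' xj a xa; have /inversionsE[ra a_gt0 xa_lt0] := xa.
  have xj_gt0 : 0 < ht (act x^-1%g (simple j)).
    have := inv_lt0 xj; rewrite invMg simple_eltV geom_act_simple_self heightN.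
    by rewrite oppr_lt0.
  have /xx'/inv_lt0 := inv_mull xj_gt0 xa.
  rewrite invgK -geom_actM => x'a_lt0; apply: invI => //.
  by rewrite invgK.
have zE : z = (s j * (s j * z))%g by rewrite mulgA simple_eltK mul1g.
have := IHl (s j * z)%g (y * s j)%g (v * s j)%g.
have -> : act (s j * z)%g (simple r) = act (s j) (act z (simple r)).
  by rewrite geom_actM.
rewrite refl_act ?simple_eltV //; last exact/root_act/root_simple.
rewrite !mulgA mul_simpleK => H.
rewrite -[(y * _)%g](mul_simpleK _ j) -[v](mul_simpleK _ j).
apply: bruhat_mulr_asc; last by rewrite act_mul_simple oppr_gt0.
apply: H.
- by rewrite -ltnS -lz.
- exact: bruhat_mulr_desc2.
- apply: simple_pos_or_eq => //; first exact/root_act/root_simple.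
  apply/eqP => zrE; have := inv_lt0 zj.
  by rewrite -zrE geom_actK lt_gtF ?simple_gt0.
- by apply: shift; rewrite -mulgA; rewrite !mulgA simple_eltK mul1g.
- by apply: shift; rewrite -zE.
Qed.

(** The inclusion makes each right descent of [v] one of [y]; cancelling it on both sides shortens
    [v], down to [v = 1], where lengths decide. *)
Lemma bruhat_eq y v : bruhat y v -> inv v^-1%g `<=` inv y^-1%g -> y = v.
Proof.
have [l] := ubnP (len v); elim: l v y => // l IHl v y lt_l le_yv vy.
have [v1|/right_descent[j lv]] := eqVneq v 1%g.
  apply/eqP; rewrite v1 -cox_length_eq0 -leqn0 -(cox_length1 C) -v1.
  exact: bruhat_len.
have vj : ht (act v (simple j)) < 0 by apply: height_simple_lt0; rewrite lv.
have yj : ht (act y (simple j)) < 0.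
  apply/inv_simpleV/vy/invI; [exact: root_simple|exact: simple_gt0|].
  by rewrite invgK.
apply: (mulIg (s j)); apply: IHl; first by rewrite -ltnS -lv.
  exact: bruhat_mulr_desc2.
move=> a /inversionsE[ra a_gt0]; rewrite invgK geom_actM => va_lt0.
apply: invI => //; rewrite invgK geom_actM.
suff /vy/inv_lt0 : inv v^-1%g (act (s j) a) by rewrite invgK.
apply: invI; [exact: root_act| |by rewrite invgK].
apply: simple_pos_or_eq => //; apply: contraTneq va_lt0 => ->.
by rewrite -geom_actM -leNgt act_mul_simple oppr_ge0 ltW.
Qed.

End Bruhat.

(** * The Bruhat preclosure *)

Section Preclosure.
Variables (R : realType) (C : coxeterSystem).
Local Notation n := (rank C).
Local Notation V := 'rV[R]_n.
Local Notation len := (@cox_length C).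
Local Notation act := (@geom_act R C).
Local Notation root := (@roots R C).
Local Notation refl := (@root_reflection R C).
Local Notation ht := (@height R C).
Local Notation inv := (@inversions R C).
Local Notation simple := (@simple_root R C).
Local Notation s := (@simple_elt C).
Local Notation bruhat := (@bruhat R C).
Implicit Types (i j r : 'I_n) (a b : V) (c u v w x y z : C) (l : seq V).

Lemma reflection_prod_rcons l a :
  reflection_prod (rcons l a) = (reflection_prod l * refl a)%g.
Proof. by rewrite /reflection_prod -cats1 big_cat big_seq1. Qed.

Lemma reflection_prod_nil : reflection_prod ([::] : seq V) = 1%g.
Proof. by rewrite /reflection_prod big_nil. Qed.

Definition partial_lengths l : seq nat :=
  [seq len (reflection_prod (take k l)) | k <- iota 1 (size l)].

Lemma partial_lengths_rcons l a :
  partial_lengths (rcons l a) =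
  rcons (partial_lengths l) (len (reflection_prod l * refl a)%g).
Proof.
rewrite /partial_lengths size_rcons -[(size l).+1]addn1 iotaD add1n map_cat /=.
rewrite take_oversize ?size_rcons // reflection_prod_rcons cats1.
congr rcons; apply/eq_in_map => k; rewrite mem_iota add1n ltnS => /andP[_ le_k].
by rewrite -cats1 takel_cat.
Qed.

Lemma last_partial_lengths l :
  last 0%N (partial_lengths l) = len (reflection_prod l).
Proof.
case/lastP: l => [|l a]; first by rewrite reflection_prod_nil cox_length1.
by rewrite partial_lengths_rcons last_rcons reflection_prod_rcons.
Qed.

Lemma length_increasing_rcons l a :
  length_increasing (rcons l a) <->
  length_increasing l /\
  (len (reflection_prod l) < len (reflection_prod l * refl a)%g)%N.
Proof.
rewrite /length_increasing -/(partial_lengths _) partial_lengths_rcons.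
rewrite rcons_path last_partial_lengths; split=> [/andP[]//|[? ?]]; exact/andP.
Qed.

(* Along an increasing path from 1 with labels in N(x), the translates of x by
   the points of the path get shorter and shorter. *)
Lemma preclosure_sub (A : set V) x :
  A `<=` inv x -> bruhat_preclosure A `<=` inv x.
Proof.
move=> A_x a [/positive_rootsE[ra a_gt0] [l [lA al incl]]].
suff shorter l' : (forall b, b \in l' -> A b) -> length_increasing l' ->
    (len (reflection_prod l' * x)%g + size l' <= len x)%N.
  apply: invI => //; apply: length_refl_lt_inv => //.
  rewrite -(cox_lengthV (_ * _)%g) invMg reflV // invgK al cox_lengthV.
  exact: leq_trans (leq_addr _ _) (shorter l lA incl).
elim/last_ind: l' => [_ _|l' b IH lA' /length_increasing_rcons[incl' up]].
  by rewrite reflection_prod_nil mul1g addn0.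
have /A_x/inversionsE[rb b_gt0 xb_lt0] : A b by apply: lA'; rewrite mem_rcons mem_head.
have Pb_gt0 : 0 < ht (act (reflection_prod l') b).
  apply: root_height_ge0 (root_act _ rb) _; rewrite leNgt; apply/negP.
  by move=> /(length_refl_lt rb b_gt0); rewrite ltnNge ltnW.
apply: leq_trans (IH _ incl'); last first.
  by move=> b' b'l; apply: lA'; rewrite mem_rcons inE b'l orbT.
rewrite size_rcons addnS -addSn leq_add2r reflection_prod_rcons.
(* Moving [refl b] across [x] conjugates it; the sign makes the resulting root positive, with
   negative image. *)
have -> : (reflection_prod l' * refl b * x =
           reflection_prod l' * x * refl (- act x^-1%g b))%g.
  rewrite refl_opp ?refl_act //; last exact: root_act.
  by rewrite invgK !mulgA mulgK.
apply: length_refl_lt; first exact/rootN/root_act.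
  by rewrite heightN oppr_gt0.
by rewrite geom_actM geom_actN geom_actKV geom_actN heightN oppr_lt0.
Qed.

(** Maximality makes every simple reflection a right descent of [v], so [v] sends nonnegative
    vectors to height at most zero. *)
Lemma inv_total v : (forall w, len w <= len v)%N ->
  forall a, root a -> 0 < ht a -> inv v a.
Proof.
move=> vmax a ra a_gt0; apply: invI => //.
apply: root_height_le0 (root_act _ ra) _; rewrite leNgt; apply/negP => e_gt0.
have e_ge0 k : 0 <= act v^-1%g a 0 k.
  by case: (root_sign (root_act v^-1%g ra)) => [[]//|[]]; rewrite lt_gtF.
move: a_gt0; rewrite -(geom_actKV v a) [act v^-1%g a]row_sum_delta.
move: e_ge0; move: (act _ a) => e e_ge0.
have act0 : act v 0 = 0 by rewrite -(scale0r 0) geom_actZ !scale0r.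
have ht0 : ht 0 = 0 by rewrite -(scale0r 0) heightZ mul0r.
rewrite (big_morph _ (geom_actD v) act0) (big_morph _ (@heightD R C) ht0).
apply/negP; rewrite -leNgt; apply: sumr_le0 => k _.
by rewrite geom_actZ heightZ mulr_ge0_le0 // ltW // height_simple_lt0.
Qed.

(** * Climbing to an upper bound of minimal length *)

Section MinimalUpperBound.
Variables u w v : C.
Hypothesis v_u : inv u `<=` inv v.
Hypothesis v_w : inv w `<=` inv v.
Hypothesis v_min : forall x, inv u `<=` inv x -> inv w `<=` inv x ->
  (len v <= len x)%N.

(** If [act v a] were positive it would be an inversion of [t], hence of [v], yet [v^-1] takes it
    back to the positive root [a]. *)
Lemma inv_complement t : inv t `<=` inv v -> inv (v^-1 * t)%g `<=` inv v^-1%g.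
Proof.
move=> v_t a /inversionsE[ra a_gt0]; rewrite invMg invgK geom_actM => ta_lt0.
apply: invI => //; rewrite invgK.
apply: root_height_le0 (root_act _ ra) _; rewrite leNgt; apply/negP => va_gt0.
have /v_t/inv_lt0 : inv t (act v a) by apply: invI => //; exact: root_act.
by rewrite geom_actK lt_gtF.
Qed.

(** The only inversion lost from [v] to [v * s j] is [- act v (simple j)], which the hypotheses
    exclude from those of [u] and [w]. *)
Lemma no_common_descent j : inv v^-1%g (simple j) ->
  inv (v^-1 * u)%g (simple j) -> inv (v^-1 * w)%g (simple j) -> False.
Proof.
move=> /inv_simpleV vj uj wj.
have vs_ub t : inv t `<=` inv v -> inv (v^-1 * t)%g (simple j) ->
    inv t `<=` inv (v * s j)%g.
  move=> v_t tj a ta; apply: inv_mulr (v_t _ ta) _ => vaE.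
  have := inv_lt0 ta; rewrite -(geom_actKV v a) vaE !geom_actN heightN.
  have := inv_lt0 tj; rewrite invMg invgK geom_actM => t_lt0.
  by rewrite oppr_lt0 lt_gtF.
have := v_min (vs_ub u v_u uj) (vs_ub w v_w wj).
rewrite leqNgt -(refl_simple R) => /negP; apply; apply: length_refl_lt => //.
- exact: root_simple.
- exact: simple_gt0.
Qed.

(** The label is [- act v b] because [y * refl b] equals [y * v^-1 * refl (act v b) * v]. *)
Lemma bruhat_climb y : bruhat y v -> y != v ->
  exists b, [/\ root b, 0 < ht (act y b), bruhat (y * refl b)%g v &
                (inv u `|` inv w) (- act v b)].
Proof.
move=> le_yv neq_yv.
pose P c := `[< inv c `<=` inv v^-1%g /\ ~ inv c `<=` inv y^-1%g >].
have Pv : P v^-1%g.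
  by apply/asboolP; split=> // /(bruhat_eq le_yv) yv; rewrite yv eqxx in neq_yv.
have [c /asboolP[c_v c_y] c_min] := arg_minnP len Pv.
have [c1|/right_descent[r lc]] := eqVneq c 1%g.
  by case: c_y => a; rewrite c1 => /inversions1.
pose z := (c * s r)%g; have cE : c = (z * s r)%g by rewrite /z mul_simpleK.
pose b := act z (simple r).
have b_gt0 : 0 < ht b by apply: height_simple_gt0; rewrite -cE lc.
have rb : root b by apply/root_act/root_simple.
have z_c : inv z `<=` inv c.
  move=> a za; rewrite cE; apply: (inv_mulr za) => zaE.
  have := inv_gt0 za; rewrite -(geom_actKV z a) zaE geom_actN heightN.
  by rewrite oppr_gt0 lt_gtF.
have c_z a : inv c a -> a <> b -> inv z a.
  move=> ca neq_ab; apply: (inv_mulr ca) => caE; apply: neq_ab.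
  by rewrite -(geom_actKV c a) caE geom_actN cE geom_act_simple_self opprK.
have short_y x : inv x `<=` inv v^-1%g -> (len x < len c)%N ->
    inv x `<=` inv y^-1%g.
  move=> x_v; rewrite ltnNge => /negP lt_x; apply: contrapT => x_y.
  by apply/lt_x/c_min/asboolP.
have z_y : inv z `<=` inv y^-1%g.
  by apply: short_y; [move=> a /z_c/c_v|rewrite lc].
have cb : inv c b.
  apply: invI => //; rewrite cE act_inv_simple /= geom_actK -[s r]mul1g.
  by rewrite geom_act_simple_self geom_act1 heightN oppr_lt0 simple_gt0.
(* The other inversions of [c] lie in [inv z], so [b] must be the one missing from [inv y^-1]. *)
have yb : ~ inv y^-1%g b.
  move=> yb; apply: c_y => a ca; have [->//|/eqP neq_ab] := eqVneq a b.
  by apply/z_y/c_z.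
have c_y' a : inv c a -> a <> b -> inv y^-1%g a by move=> ca /(c_z a ca)/z_y.
exists b; split=> //.
- by have := notinv_gt0 rb b_gt0 yb; rewrite invgK.
- by apply: bruhat_reflection => //; rewrite -cE.
have vb : 0 < ht (- act v b).
  by rewrite heightN oppr_gt0; have := inv_lt0 (c_v _ cb); rewrite invgK.
have not_both : ~ (inv (v^-1 * u)%g b /\ inv (v^-1 * w)%g b).
  move=> [ub wb].
  have escape x := @minimal_escape R C c v^-1%g y^-1%g x b c_v short_y cb yb c_y'.
  have c_u := escape _ (inv_complement v_u) ub.
  have c_w := escape _ (inv_complement v_w) wb.
  have [|j _ cj] := @left_descent R C c.
    by apply: contra_eq_neq lc => ->; rewrite cox_length1.
  exact: (no_common_descent (c_v _ cj) (c_u _ cj) (c_w _ cj)).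
have inv_or t : ~ inv (v^-1 * t)%g b -> inv t (- act v b).
  move=> tb; apply: invI vb _; first exact/rootN/root_act.
  have := notinv_gt0 rb b_gt0 tb; rewrite invMg invgK geom_actM => tvb_gt0.
  by rewrite geom_actN heightN oppr_lt0.
have [ub|ub] := pselect (inv (v^-1 * u)%g b); last by left; apply: inv_or.
by right; apply: inv_or => wb; apply: not_both.
Qed.

(** Each climb from [x * v] towards [v] shortens [x] by a reflection on the right. The first climb
    supplies the last label of the path. *)
Lemma increasing_path x : bruhat (x * v)%g v ->
  exists l, [/\ forall b, b \in l -> (inv u `|` inv w) b,
                x = reflection_prod l & length_increasing l].
Proof.
have [m] := ubnP (len x); elim: m x => // m IHm x lt_m le_xv.
have [xv|neq_xv] := eqVneq (x * v)%g v.
  exists [::]; split=> //; rewrite reflection_prod_nil.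
  by apply: (mulIg v); rewrite xv mul1g.
have [b [rb xvb_gt0 le_v ab]] := bruhat_climb le_xv neq_xv.
set a := - act v b in ab.
have ra : root a by exact/rootN/root_act.
have a_gt0 : 0 < ht a by case: ab => /inv_gt0.
have lt_x : (len (x * refl a)%g < len x)%N.
  apply: length_refl_lt => //.
  by rewrite /a geom_actN -geom_actM heightN oppr_lt0.
have xaE : (x * v * refl b = x * refl a * v)%g.
  rewrite /a refl_opp ?refl_act //; last exact: root_act.
  by rewrite !mulgA mulgKV.
have [|l [lA xl incl]] := IHm _ (leq_trans lt_x (ltnSE lt_m)).
  by rewrite -xaE.
exists (rcons l a); split.
- by move=> b'; rewrite mem_rcons inE => /orP[/eqP->//|/lA].
- by rewrite reflection_prod_rcons -xl refl_mulK.
- by apply/length_increasing_rcons; split=> //; rewrite -xl refl_mulK.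
Qed.

Lemma inv_preclosure : inv v = bruhat_preclosure (inv u `|` inv w).
Proof.
apply/seteqP; split=> [a va|]; last first.
  by apply: preclosure_sub => a [/v_u|/v_w].
have /inversionsE[ra a_gt0 va_lt0] := va; split; first exact/positive_rootsE.
apply: increasing_path; pose e := - act v^-1%g a.
have re : root e by exact/rootN/root_act.
have e_gt0 : 0 < ht e by rewrite heightN oppr_gt0.
have ve : act v e = - a by rewrite geom_actN geom_actKV.
have av : (refl a * v = v * refl e)%g.
  by rewrite /e refl_opp ?refl_act ?invgK ?mulgA ?mulgV ?mul1g //; exact: root_act.
(* Since [refl a * v = v * refl e], a single step by [e] leads back up to [v]. *)
apply: (bruhat_step re e_gt0).
  by rewrite geom_actM ve geom_actN geom_act_refl_self // opprK.
by rewrite av refl_mulK //; apply: bruhat_refl.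
Qed.

End MinimalUpperBound.

End Preclosure.

Theorem corollary1p3 (R : realType) (C : coxeterSystem) (u w : C) :
  inversions R (weak_join R u w) =
  bruhat_preclosure (inversions R u `|` inversions R w)%classic.
Proof.
pose ub x := `[< inversions R u `<=` inversions R x /\
                 inversions R w `<=` inversions R x >].
(* An element of maximal length has every positive root as an inversion. *)
have [v0 ub0] : exists v0, ub v0.
  have [v0 _ v0max] := @arg_maxnP C 1%g xpredT (@cox_length C) isT.
  exists v0; apply/asboolP.
  by split=> a /inversionsE[ra a_gt0 _]; apply: inv_total => // x; apply: v0max.
have [v /asboolP[v_u v_w] v_min] := arg_minnP (@cox_length C) ub0.
have vE : inversions R v = bruhat_preclosure (inversions R u `|` inversions R w).
  apply: inv_preclosure => // x x_u x_w; apply: v_min; exact/asboolP.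
have v_join : is_join R u w v.
  split=> // x x_u x_w; rewrite /weak_le vE.
  by apply: preclosure_sub => a [/x_u|/x_w].
(* [v] witnesses that [xget] returns a join; two joins lie below each other, so their inversion sets
   agree. *)
have [j_u j_w j_min] : is_join R u w (weak_join R u w).
  by rewrite /weak_join; case: xgetP => [? _ //|/(_ v)].
rewrite -vE; apply/seteqP; split; first exact: j_min.
by case: v_join => _ _; apply.
Qed.
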